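(* The matrix $$A_{153}:=\begin{pmatrix}16&8&-11\\ 9&-16&5\\ 14&-1&-11\end{pmatrix}$$ has $9$ distinct regular Pareto eigenvalues and admits an assigned support map with detailed profile $(1,0,0;1,2,2;3)$.
   Context: Vector inequalities are componentwise ($u>0$ means all components are positive). For $A\in\mathbb{R}^{n\times n}$, a real number $\lambda$ is a Pareto eigenvalue of $A$ if there is $x\in\mathbb{R}^n\setminus\{0\}$ with $x\ge 0$, $Ax-\lambda x\ge 0$ and $\langle x,Ax-\lambda x\rangle=0$. The set of Pareto eigenvalues is $\Pi(A)$. A support is a nonempty subset $J\subseteq\{1,\dots,n\}$, with complement $J^{\mathrm c}$; $A_J$ is the principal submatrix indexed by $J$ and $A_{J^{\mathrm c},J}$ is the submatrix with rows in $J^{\mathrm c}$ and columns in $J$. The support $J$ produces $\lambda\in\mathbb{R}$ if there is $u\in\mathbb{R}^{|J|}$ with $A_Ju=\lambda u$, $u>0$, $A_{J^{\mathrm c},J}u\ge 0$. The set of values produced by $J$ is $\Pi_J(A)$; one has $\Pi(A)=\bigcup_J\Pi_J(A)$. A value $\lambda\in\Pi_J(A)$ is regularly produced by $J$ if it is an algebraically simple eigenvalue of $A_J$ and every component of $A_{J^{\mathrm c},J}u$ is positive, where $u$ is the vector above (the second condition is empty if $J=\{1,\dots,n\}$). A Pareto eigenvalue is regular if it is regularly produced by at least one support. An assigned support map for $A$ is a map $\tau$ from $\Pi(A)$ to the set of supports such that $\lambda\in\Pi_{\tau(\lambda)}(A)$ for every $\lambda\in\Pi(A)$. Put $m_J:=|\{\lambda\in\Pi(A):\tau(\lambda)=J\}|$.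 For $n=3$ the detailed (assigned) profile is $(m_1,m_2,m_3;m_{12},m_{13},m_{23};m_{123})$, where $m_i=m_{\{i\}}$, $m_{ij}=m_{\{i,j\}}$, $m_{123}=m_{\{1,2,3\}}$. *)

(* Defs.v *)
From HB Require Import structures.
From mathcomp Require Import all_boot all_order all_algebra.
From mathcomp Require Import boolp classical_sets functions cardinality reals.

Set Implicit Arguments.
Unset Strict Implicit.
Unset Printing Implicit Defensive.

Import Order.TTheory GRing.Theory Num.Theory.
Local Open Scope ring_scope.
Local Open Scope classical_set_scope.
Local Open Scope card_scope.

Section Pareto.
Variables (R : realType) (n : nat).
Implicit Types (A : 'M[R]_n) (J : {set 'I_n}) (l : R).

Definition pareto_eigenvalue A l : Prop :=
  exists x : 'cV[R]_n,
    [/\ x != 0,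
        forall i, 0 <= x i 0,
        forall i, 0 <= (A *m x - l *: x) i 0
      & \sum_i x i 0 * (A *m x - l *: x) i 0 = 0].

Definition pareto_spectrum A : set R := [set l | pareto_eigenvalue A l].

Definition is_support J : Prop := J != finset.set0.

Definition principal_submx A J : 'M[R]_#|J| :=
  mxsub (@enum_val _ (mem J)) (@enum_val _ (mem J)) A.

Definition outer_submx A J : 'M[R]_(#|(~: J)%SET|, #|J|) :=
  mxsub (@enum_val _ (mem (~: J)%SET)) (@enum_val _ (mem J)) A.

Definition producing_vector A J l (u : 'cV[R]_#|J|) : Prop :=
  [/\ principal_submx A J *m u = l *: u,
      forall i, 0 < u i 0
    & forall i, 0 <= (outer_submx A J *m u) i 0].

(* Only meaningful when J is a support: the empty J would produce every real. *)
Definition produced_values A J : set R :=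
  [set l | exists u, @producing_vector A J l u].

Definition simple_eigenvalue m (B : 'M[R]_m) l : Prop :=
  mup l (char_poly B) = 1%N.

(* When l is simple, u is unique up to a positive factor, so the existential
   over u does not depend on the choice of u. *)
Definition regularly_produced A J l : Prop :=
  simple_eigenvalue (principal_submx A J) l /\
  exists2 u, @producing_vector A J l u &
    forall i, 0 < (outer_submx A J *m u) i 0.

Definition regular_pareto_spectrum A : set R :=
  [set l | pareto_eigenvalue A l /\
    exists2 J, is_support J & regularly_produced A J l].

(* An assigned support map is encoded as a total function on R, of which only
   the restriction to the Pareto spectrum of A matters. *)
Definition assigned_support_map A (tau : R -> {set 'I_n}) : Prop :=
  forall l, pareto_spectrum A l ->
    is_support (tau l) /\ produced_values A (tau l) l.

(* m_J = m, stated as a relation so that it also forces finiteness. *)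
Definition support_count A (tau : R -> {set 'I_n}) J (m : nat) : Prop :=
  [set l | pareto_spectrum A l /\ tau l = J] #= `I_m.

End Pareto.

(* Indices are shifted by one: 1, 2, 3 become the ordinals 0, 1, 2. *)
Definition has_detailed_profile (R : realType) (A : 'M[R]_3)
    (tau : R -> {set 'I_3}) (m1 m2 m3 m12 m13 m23 m123 : nat) : Prop :=
  [/\ support_count A tau [set 0]%SET m1,
      support_count A tau [set 1]%SET m2
    & support_count A tau [set 2]%SET m3] /\
  [/\ support_count A tau [set 0; 1]%SET m12,
      support_count A tau [set 0; 2]%SET m13
    & support_count A tau [set 1; 2]%SET m23] /\
  support_count A tau [set: 'I_3]%SET m123.

Definition A153 (R : realType) : 'M[R]_3 :=
  \matrix_(i < 3, j < 3)
    (nth [::] [:: [:: 16;   8; -11];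
                  [::  9; -16;   5];
                  [:: 14;  -1; -11]] i)`_j.

(* Main.v *)
Require Import Defs.
From mathcomp Require Import all_boot all_order all_algebra.
From mathcomp Require Import boolp classical_sets functions cardinality reals.
From mathcomp Require Import finmap ring lra.

Set Implicit Arguments.
Unset Strict Implicit.
Unset Printing Implicit Defensive.

Import Order.TTheory GRing.Theory Num.Theory.
Local Open Scope ring_scope.

(** Splitting an equation of Pareto type by the support of x shows that a Pareto
    eigenvalue of A153 is 16, the positive root of X^2 - 328, or a root of
    X^2 - 5X - 22, X^2 + 27X + 181 or X^3 + 11X^2 - 169X - 1883, the
    characteristic polynomials of the principal submatrices. Sign changes isolate
    nine such numbers in disjoint intervals. Each principal submatrix has an
    eigenvector that is polynomial in the eigenvalue; the intervals make it
    positive and the outer inequalities strict. As a principal submatrix of size m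
    has m distinct eigenvalues, each of them is simple. *)

(** * Characteristic polynomials and real roots *)

Lemma char_poly_trmx (R : comNzRingType) m (B : 'M[R]_m) : char_poly B^T = char_poly B.
Proof.
by rewrite /char_poly -det_tr /char_poly_mx linearB /= tr_scalar_mx map_trmx trmxK.
Qed.

(** The characteristic polynomial is monic of degree m, so m distinct roots determine it. The
    transpose enters because [eigenvalue] is about row vectors. *)
Lemma uniq_eigenvalues_char_poly (F : fieldType) m (B : 'M[F]_m) (s : seq F) :
  uniq s -> size s = m -> {in s, forall l, exists2 v : 'cV_m, v != 0 & B *m v = l *: v} ->
  char_poly B = \prod_(l <- s) ('X - l%:P).
Proof.
move=> us sm es; rewrite [LHS](@all_roots_prod_XsubC _ _ s) ?size_char_poly ?sm //.
- by rewrite (monicP (char_poly_monic B)) scale1r.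
- apply/allP => l /es[v v0 Bv]; rewrite -char_poly_trmx -eigenvalue_root_char.
  by apply/eigenvalueP; exists v^T; rewrite ?trmx_eq0// -?trmx_mul ?trmx_eq0 Bv linearZ.
- by rewrite uniq_rootsE.
Qed.

(** [s] lists coefficients from the constant term up, and [f] is a readable form of the polynomial.
    The strict sign change keeps the root off both endpoints. *)
Lemma Poly_root_between (R : rcfType) (s : seq R) f a b :
  horner_rec s =1 f -> a <= b -> f a * f b < 0 -> exists2 x, a < x < b & f x = 0.
Proof.
move=> sE; rewrite -!sE -!horner_Poly => ab sab; set p := Poly s in sab *.
have [x /andP[ax xb] px] : exists2 x, a <= x <= b & p.[x] = 0.
  have [pa|pa] := leP p.[a] 0.
    have pab : p.[a] <= 0 <= p.[b].
      by rewrite pa leNgt; apply: contraTN sab => pb; rewrite -leNgt; nra.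
    by have [x xab /rootP] := poly_ivt ab pab; exists x.
  (* [poly_ivt] wants a nonpositive value on the left, so it is applied to - p here. *)
  have pab : (- p).[a] <= 0 <= (- p).[b].
    rewrite !hornerN oppr_le0 oppr_ge0 ltW// leNgt.
    by apply: contraTN sab => pb; rewrite -leNgt; nra.
  have [x xab /rootP] := poly_ivt ab pab.
  by rewrite hornerN => /eqP; rewrite oppr_eq0 => /eqP; exists x.
exists x; last by rewrite -sE -horner_Poly.
by rewrite !lt_neqAle ax xb !andbT; apply/andP; split;
  [apply: contraTneq sab => -> | apply: contraTneq sab => <-];
  rewrite px ?mul0r ?mulr0 ltxx.
Qed.

(** [c] holds the coefficients below the leading 1, so [size c] is the degree; a root outside [s]
    would be one too many. *)
Lemma monic_roots (R : idomainType) (c s : seq R) f x :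
  horner_rec (rcons c 1) =1 f -> uniq s -> size s = size c ->
  {in s, forall y, f y = 0} -> f x = 0 -> x \in s.
Proof.
move=> cE us sc sr xr; apply: contraT => xs.
have sp : size (Poly (rcons c 1)) = (size c).+1.
  by rewrite (@PolyK _ 0) ?last_rcons ?oner_eq0// size_rcons.
have p0 : Poly (rcons c 1) != 0 by rewrite -size_poly_eq0 sp.
have : (size (x :: s) < size (Poly (rcons c 1%R)))%N.
  apply: max_poly_roots => //=; last by rewrite xs.
  rewrite rootE horner_Poly cE xr eqxx /=.
  by apply/allP => y /sr ys; rewrite rootE horner_Poly cE ys.
by rewrite sp /= sc ltnn.
Qed.

(** * Counting and indices in ['I_3] *)

Lemma card_eq_seq (T : choiceType) (S : set T) (s : seq T) :
  uniq s -> (forall x, S x <-> x \in s) -> (S #= `I_(size s))%card.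
Proof.
move=> us Ss; have -> : S = [set` seq_fset tt s]%classic.
  by apply/seteqP; split=> x /=; rewrite Ss -(seq_fsetE tt).
by apply/card_eq_fsetP; rewrite size_seq_fset undup_id.
Qed.

Lemma enum_ord3 : enum 'I_3 = [:: 0; 1; 2%:R].
Proof. by apply: (inj_map val_inj); rewrite val_enum_ord. Qed.

Lemma sum_ord3 (V : nmodType) (F : 'I_3 -> V) : \sum_i F i = F 0 + F 1 + F 2%:R.
Proof.
rewrite !big_ord_recl big_ord0 addr0 addrA.
by congr (F _ + F _ + F _); exact: val_inj.
Qed.

Lemma forall_ord3 (P : 'I_3 -> Prop) : (forall i, P i) <-> [/\ P 0, P 1 & P 2%:R].
Proof.
split=> [Pi|[P0 P1 P2] [[|[|[|//]]] i3]]; first by split.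
- by rewrite (_ : Ordinal i3 = 0) //; exact: val_inj.
- by rewrite (_ : Ordinal i3 = 1) //; exact: val_inj.
- by rewrite (_ : Ordinal i3 = 2%:R) //; exact: val_inj.
Qed.

(** Finite sets do not reduce under evaluation; membership vectors are boolean lists, which can be
    compared and counted by computation. *)
Definition mem_ord3 (J : {set 'I_3}) := [:: 0 \in J; 1 \in J; 2%:R \in J].

Lemma mem_ord3_inj : injective mem_ord3.
Proof. by move=> J K [J0 J1 J2]; apply/setP/forall_ord3. Qed.

(** * Submatrices, complementarity and production *)

Section Profile153.
Variable R : realType.

(** Trades [enum_val] for explicit tuples, so that the submatrices have literal sizes and computable
    entries. *)
Lemma regularly_produced_tuple n (A : 'M[R]_n) (J : {set 'I_n}) k k'
    (p : k.-tuple 'I_n) (q : k'.-tuple 'I_n) l (u : 'cV[R]_k) :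
  enum J = p -> enum (~: J)%SET = q ->
  simple_eigenvalue (mxsub (tnth p) (tnth p) A) l ->
  mxsub (tnth p) (tnth p) A *m u = l *: u ->
  (forall i, 0 < u i 0) -> (forall i, 0 < (mxsub (tnth q) (tnth p) A *m u) i 0) ->
  regularly_produced A J l.
Proof.
move=> eJ eJ'.
have ek : k = #|J| by rewrite cardE eJ size_tuple.
have ek' : k' = #|(~: J)%SET| by rewrite cardE eJ' size_tuple.
subst k k'.
have ep : tnth p =1 @enum_val _ (mem J).
  by move=> i; rewrite /enum_val (tnth_nth (enum_default i)) eJ.
have eq : tnth q =1 @enum_val _ (mem (~: J)%SET).
  by move=> i; rewrite /enum_val (tnth_nth (enum_default i)) eJ'.
rewrite /regularly_produced /producing_vector /outer_submx /principal_submx.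
rewrite -(funext ep) -(funext eq) => sl Au u0 Au0.
by split=> //; exists u => //; split=> // i; exact: ltW.
Qed.

Lemma pareto_A153E l (x : 'cV[R]_3) (a := x 0 0) (b := x 1 0) (c := x 2%:R 0) :
  A153 R *m x - l *: x = \col_i [:: 16 * a + 8 * b - 11 * c - l * a;
     9 * a - 16 * b + 5 * c - l * b; 14 * a - b - 11 * c - l * c]`_i.
Proof.
apply/colP; apply/forall_ord3; rewrite !mxE !sum_ord3 !mxE /=.
rewrite -/a -/b -/c; split; ring.
Qed.

Lemma pareto_A153_conditions l : pareto_eigenvalue (A153 R) l ->
  exists a b c (p := 16 * a + 8 * b - 11 * c - l * a)
    (q := 9 * a - 16 * b + 5 * c - l * b) (r := 14 * a - b - 11 * c - l * c),
    [/\ 0 <= a, 0 <= b, 0 <= c & 0 < a + b + c] /\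
    [/\ [/\ 0 <= p, 0 <= q & 0 <= r], a * p = 0, b * q = 0 & c * r = 0].
Proof.
move=> [x [x0 x_ge0]].
rewrite pareto_A153E => w_ge0 xw.
exists (x 0 0), (x 1 0), (x 2%:R 0); split; first split=> //.
  rewrite lt_def !addr_ge0 // andbT; apply: contraNneq x0 => x0.
  have {}x0 : \sum_i x i 0 = 0 by rewrite sum_ord3.
  apply/eqP/colP => i; rewrite mxE.
  by apply: (psumr_eq0P _ x0).
(* A zero sum of nonnegative terms is zero term by term: orthogonality becomes complementarity. *)
have {}xw := psumr_eq0P (fun i _ => mulr_ge0 (x_ge0 i) (w_ge0 i)) xw.
move/forall_ord3: w_ge0; rewrite !mxE /= => w_ge0; split=> //.
- by have := xw 0 isT; rewrite mxE.
- by have := xw 1 isT; rewrite mxE.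
- by have := xw 2%:R isT; rewrite mxE.
Qed.

(** Extend u by zero: then x vanishes off J and A x - l x vanishes on J, so the two are
    orthogonal. *)
Lemma producing_vector_pareto n (A : 'M[R]_n) (J : {set 'I_n}) l u :
  is_support J -> @producing_vector R n A J l u -> pareto_eigenvalue A l.
Proof.
move=> J0 [Au u_gt0 Au_ge0].
pose e := @enum_val _ (mem J).
(* The sum has one term for i in J and none otherwise, which avoids an inverse of [e]. *)
pose x : 'cV[R]_n := \col_i \sum_(j | e j == i) u j 0.
have xe j : x (e j) 0 = u j 0.
  rewrite mxE (big_pred1 j) // => k; exact/inj_eq/enum_val_inj.
have xJ' i : i \notin J -> x i 0 = 0.
  move=> iJ; rewrite mxE big_pred0// => j; apply: contraNF iJ => /eqP <-.
  exact: enum_valP.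
have Ax i : (A *m x) i 0 = \sum_j A i (e j) * u j 0.
  rewrite mxE (bigID (mem J)) /= [X in _ + X]big1 ?addr0; last first.
    by move=> k /xJ' ->; rewrite mulr0.
  by rewrite big_enum_val; apply: eq_bigr => j _; rewrite xe.
have wE i : (A *m x - l *: x) i 0 = \sum_j A i (e j) * u j 0 - l * x i 0.
  by rewrite mxE Ax [X in _ + X]mxE [X in _ - X]mxE.
have wJ j : (A *m x - l *: x) (e j) 0 = 0.
  have /colP/(_ j) := Au; rewrite wE xe !mxE => <-; apply/eqP; rewrite subr_eq0.
  by apply/eqP/eq_bigr => k _; rewrite mxE.
have eJ i : i \in J -> exists j, i = e j.
  by move=> iJ; exists (enum_rank_in iJ i); rewrite /e enum_rankK_in.
exists x; split.
- have /finset.set0Pn[i /eJ[j _]] := J0; apply/eqP => /colP/(_ (e j)).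
  by rewrite xe mxE => uj; move: (u_gt0 j); rewrite uj ltxx.
- move=> i; case: (boolP (i \in J)) => [/eJ[j ->]|/xJ' -> //].
  by rewrite xe ltW.
- move=> i; case: (boolP (i \in J)) => [/eJ[j ->]|iJ]; first by rewrite wJ.
  have iJ' : i \in (~: J)%SET by rewrite inE.
  have := Au_ge0 (enum_rank_in iJ' i).
  rewrite wE xJ'// mulr0 subr0 mxE; congr (_ <= _); apply: eq_bigr => k _.
  by rewrite mxE enum_rankK_in.
- rewrite big1// => i _; case: (boolP (i \in J)) => [/eJ[j ->]|/xJ' ->].
    by rewrite wJ mulr0.
  by rewrite mul0r.
Qed.

Lemma uniq_eigenvalues_simple m (B : 'M[R]_m) (s : seq R) l :
  uniq s -> size s = m ->
  {in s, forall x, exists2 v : 'cV_m, v != 0 & B *m v = x *: v} ->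
  l \in s -> simple_eigenvalue B l.
Proof.
move=> us sm es ls; rewrite /simple_eigenvalue.
by rewrite (uniq_eigenvalues_char_poly us sm es) mu_prod_XsubC count_uniq_mem// ls.
Qed.

(** * Explicit eigenvectors for the producing supports *)

Lemma regularly_produced_A153_1 : regularly_produced (A153 R) [set 0]%SET 16.
Proof.
have B : mxsub (tnth [tuple 0]) (tnth [tuple 0]) (A153 R) = 16%:M.
  by apply/matrixP => i j; rewrite !ord1 !mxE.
apply: (@regularly_produced_tuple _ _ _ _ _ [tuple 0] [tuple 1; 2%:R] _ 1%:M).
- by rewrite /enum_mem -enumT enum_ord3 /= !inE.
- by rewrite /enum_mem -enumT enum_ord3 /= !inE.
- apply: (@uniq_eigenvalues_simple _ _ [:: 16]) => //; last by rewrite inE.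
  move=> x; rewrite inE => /eqP ->.
  exists 1%:M; last by rewrite B mulmx1 scalemx1.
  by apply/eqP => /matrixP/(_ 0 0)/eqP; rewrite !mxE oner_eq0.
- by rewrite B mulmx1 scalemx1.
- by move=> i; rewrite ord1 mxE.
- by move=> -[[|[|//]] ?]; rewrite mulmx1 !mxE /=; lra.
Qed.

(** The vector (8, l - 16) solves the first row for every l, and the outer component is 128 - l. The
    list [s] contains both roots because simplicity comes from counting eigenvalues; positivity is
    asked of l alone. *)
Lemma regularly_produced_A153_12 (s : seq R) l :
  uniq s -> size s = 2 -> {in s, forall x, x ^+ 2 - 328 = 0} -> l \in s ->
  16 < l < 128 -> regularly_produced (A153 R) [set 0; 1]%SET l.
Proof.
move=> us s2 sr ls /andP[l16 l128].
pose v x : 'cV[R]_2 := \col_i [:: 8; x - 16]`_i.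
pose B := mxsub (tnth [tuple 0; 1]) (tnth [tuple 0; 1]) (A153 R).
have Bv x : x \in s -> B *m v x = x *: v x.
  move=> /sr xr; apply/colP => -[[|[|//]] ?];
    rewrite !mxE big_ord_recl big_ord1 !mxE /=; lra.
apply: (@regularly_produced_tuple _ _ _ _ _ [tuple 0; 1] [tuple 2%:R] _ (v l)).
- by rewrite /enum_mem -enumT enum_ord3 /= !inE.
- by rewrite /enum_mem -enumT enum_ord3 /= !inE.
- apply: (uniq_eigenvalues_simple us) => // x /Bv; exists (v x) => //.
  by apply/eqP => /colP/(_ 0); rewrite !mxE /=; lra.
- exact: Bv.
- by move=> -[[|[|//]] ?]; rewrite !mxE /=; lra.
- by move=> i; rewrite ord1 !mxE big_ord_recl big_ord1 !mxE /=; lra.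
Qed.

(** For the vector (11, 16 - l) the outer component is 179 - 5 l, already positive when l < 16. *)
Lemma regularly_produced_A153_13 (s : seq R) l :
  uniq s -> size s = 2 -> {in s, forall x, x ^+ 2 - 5 * x - 22 = 0} -> l \in s ->
  l < 16 -> regularly_produced (A153 R) [set 0; 2%:R]%SET l.
Proof.
move=> us s2 sr ls l16.
pose v x : 'cV[R]_2 := \col_i [:: 11; 16 - x]`_i.
pose B := mxsub (tnth [tuple 0; 2%:R]) (tnth [tuple 0; 2%:R]) (A153 R).
have Bv x : x \in s -> B *m v x = x *: v x.
  move=> /sr xr; apply/colP => -[[|[|//]] ?];
    rewrite !mxE big_ord_recl big_ord1 !mxE /=; lra.
apply: (@regularly_produced_tuple _ _ _ _ _ [tuple 0; 2%:R] [tuple 1] _ (v l)).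
- by rewrite /enum_mem -enumT enum_ord3 /= !inE.
- by rewrite /enum_mem -enumT enum_ord3 /= !inE.
- apply: (uniq_eigenvalues_simple us) => // x /Bv; exists (v x) => //.
  by apply/eqP => /colP/(_ 0); rewrite !mxE /=; lra.
- exact: Bv.
- by move=> -[[|[|//]] ?]; rewrite !mxE /=; lra.
- by move=> i; rewrite ord1 !mxE big_ord_recl big_ord1 !mxE /=; lra.
Qed.

(** For the vector (5, 16 + l) the outer component is - 136 - 11 l. Its negative is the first
    component of the full-support eigenvector, so the two supports produce values on opposite sides
    of - 136 / 11. *)
Lemma regularly_produced_A153_23 (s : seq R) l :
  uniq s -> size s = 2 -> {in s, forall x, x ^+ 2 + 27 * x + 181 = 0} -> l \in s ->
  - 16 < l < - (136 / 11) -> regularly_produced (A153 R) [set 1; 2%:R]%SET l.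
Proof.
move=> us s2 sr ls /andP[l16 l12].
pose v x : 'cV[R]_2 := \col_i [:: 5; 16 + x]`_i.
pose B := mxsub (tnth [tuple 1; 2%:R]) (tnth [tuple 1; 2%:R]) (A153 R).
have Bv x : x \in s -> B *m v x = x *: v x.
  move=> /sr xr; apply/colP => -[[|[|//]] ?];
    rewrite !mxE big_ord_recl big_ord1 !mxE /=; lra.
apply: (@regularly_produced_tuple _ _ _ _ _ [tuple 1; 2%:R] [tuple 0] _ (v l)).
- by rewrite /enum_mem -enumT enum_ord3 /= !inE.
- by rewrite /enum_mem -enumT enum_ord3 /= !inE.
- apply: (uniq_eigenvalues_simple us) => // x /Bv; exists (v x) => //.
  by apply/eqP => /colP/(_ 0); rewrite !mxE /=; lra.
- exact: Bv.
- by move=> -[[|[|//]] ?]; rewrite !mxE /=; lra.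
- by move=> i; rewrite ord1 !mxE big_ord_recl big_ord1 !mxE /=; lra.
Qed.

Lemma regularly_produced_A153_123 (s : seq R) l :
  uniq s -> size s = 3 ->
  {in s, forall x, x ^+ 3 + 11 * x ^+ 2 - 169 * x - 1883 = 0 /\ - (136 / 11) < x < 18} ->
  l \in s -> regularly_produced (A153 R) [set: 'I_3]%SET l.
Proof.
move=> us s3 sr ls.
(* Minus the cross product of the first two rows of [A153 - x]. *)
pose v x : 'cV[R]_3 := \col_i [:: 11 * x + 136; 179 - 5 * x; 328 - x ^+ 2]`_i.
pose B := mxsub (tnth [tuple 0; 1; 2%:R]) (tnth [tuple 0; 1; 2%:R]) (A153 R).
have Bv x : x \in s -> B *m v x = x *: v x.
  move=> /sr[xr _]; apply/colP => -[[|[|[|//]]] ?];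
    rewrite !mxE sum_ord3 !mxE /=; lra.
apply: (@regularly_produced_tuple _ _ _ _ _ [tuple 0; 1; 2%:R] [tuple] _ (v l)).
- by rewrite /enum_mem -enumT enum_ord3 /= !inE.
- by rewrite /enum_mem -enumT enum_ord3 /= !inE.
- apply: (uniq_eigenvalues_simple us) => // x xs; exists (v x); last exact: Bv.
  have [_ xb] := sr x xs.
  by apply/eqP => /colP/(_ 0); rewrite !mxE /=; lra.
- exact: Bv.
(* Here 5 l < 90 < 179 and l ^ 2 < 18 ^ 2 = 324 < 328. *)
- have [_ /andP[l12 l18]] := sr l ls.
  by move=> -[[|[|[|//]]] ?]; rewrite !mxE /=; nra.
- by case.
Qed.

(** * Equations satisfied by the Pareto eigenvalues *)

Lemma pareto_A153_equation l : pareto_eigenvalue (A153 R) l ->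
  l = 16 \/ [\/ 0 < l /\ l ^+ 2 - 328 = 0, l ^+ 2 - 5 * l - 22 = 0,
    l ^+ 2 + 27 * l + 181 = 0 | l ^+ 3 + 11 * l ^+ 2 - 169 * l - 1883 = 0].
Proof.
move=> /pareto_A153_conditions[a [b [c /= [[a0 b0 c0 abc] [[p0 q0 r0] ap bq cr]]]]].
have nzP x y : 0 <= x -> x * y = 0 -> x != 0 -> 0 < x /\ y = 0 :> R.
  by move=> x0 xy xn; rewrite lt_def xn x0; split=> //; apply: (mulfI xn); rewrite xy mulr0.
have mulP x y : 0 < x -> y * x = 0 -> y = 0 :> R.
  by move=> x0 yx; apply: (mulIf (lt0r_neq0 x0)); rewrite yx mul0r.
have [az|/(nzP _ _ a0 ap)[agt0 p]] := eqVneq a 0;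
have [bz|/(nzP _ _ b0 bq)[bgt0 q]] := eqVneq b 0;
have [cz|/(nzP _ _ c0 cr)[cgt0 r]] := eqVneq c 0;
clear ap bq cr; subst.
- by move: abc; rewrite !addr0 ltxx.
(* With only c positive the first inequality reads 0 <= - 11 c; with only b positive, in the next
   case, the third reads 0 <= - b. *)
- by exfalso; lra.
- by exfalso; lra.
(* With two positive coordinates, eliminating one leaves the characteristic polynomial times the
   other. *)
- by right; apply: Or43; apply: (mulP c) => //; nra.
- by left; apply/eqP; rewrite -subr_eq0 -oppr_eq0; apply/eqP/(mulP a) => //; lra.
- by right; apply: Or42; apply: (mulP a) => //; nra.
- right; apply: Or41; split; last by apply: (mulP a) => //; nra.
  (* If l <= 0, then 16 a + 8 b - l a > 0, against [p]. *)
  by rewrite ltNge; apply/negP => l0; nra.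
- right; apply: Or44; apply: (mulP a) => //.
  (* Expansion along the first row of the adjugate of [A153 - l]. *)
  transitivity (- (((16 + l) * (11 + l) + 5) * (16 * a + 8 * b - 11 * c - l * a)
    + (99 + 8 * l) * (9 * a - 16 * b + 5 * c - l * b)
    - (136 + 11 * l) * (14 * a - b - 11 * c - l * c))); first by ring.
  by rewrite p q r !mulr0 subr0 addr0 oppr0.
Qed.

End Profile153.

(** * The nine eigenvalues and their supports *)

Theorem proposition6p2 (R : realType) :
  (regular_pareto_spectrum (A153 R) #= `I_9)%card /\
  exists tau : R -> {set 'I_3},
    assigned_support_map (A153 R) tau /\
    has_detailed_profile (A153 R) tau 1 0 0 1 2 2 3.
Proof.
pose chi (x : R) := x ^+ 3 + 11 * x ^+ 2 - 169 * x - 1883.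
have chiE x : horner_rec [:: - 1883; - 169; 11; 1] x = chi x by rewrite /chi /=; ring.
have q12E (x : R) : horner_rec [:: - 328; 0; 1] x = x ^+ 2 - 328 by rewrite /=; ring.
have q13E (x : R) : horner_rec [:: - 22; - 5; 1] x = x ^+ 2 - 5 * x - 22.
  by rewrite /=; ring.
have q23E (x : R) : horner_rec [:: 181; 27; 1] x = x ^+ 2 + 27 * x + 181.
  by rewrite /=; ring.
have [x123 bx123 rx123] : exists2 x, - (49 / 4) < x < - 12 & chi x = 0.
  by apply: (Poly_root_between chiE); rewrite /chi; lra.
have [y123 by123 ry123] : exists2 x, - 12 < x < - 11 & chi x = 0.
  by apply: (Poly_root_between chiE); rewrite /chi; lra.
have [z123 bz123 rz123] : exists2 x, 13 < x < 14 & chi x = 0.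
  by apply: (Poly_root_between chiE); rewrite /chi; lra.
have [x12 bx12 rx12] : exists2 x, 18 < x < 19 & x ^+ 2 - 328 = 0 :> R.
  by apply: (Poly_root_between q12E); lra.
have [x13 bx13 rx13] : exists2 x, 7 < x < 8 & x ^+ 2 - 5 * x - 22 = 0 :> R.
  by apply: (Poly_root_between q13E); lra.
have [y13 by13 ry13] : exists2 x, - 3 < x < - 2 & x ^+ 2 - 5 * x - 22 = 0 :> R.
  by apply: (Poly_root_between q13E); lra.
(* This root must be shown to lie below - 136 / 11 = - 12.3636..., which is close to it; hence the
   narrow interval. *)
have [x23 bx23 rx23] :
    exists2 x, - (62 / 5) < x < - (1237 / 100) & x ^+ 2 + 27 * x + 181 = 0 :> R.
  by apply: (Poly_root_between q23E); lra.
have [y23 by23 ry23] : exists2 x, - 15 < x < - 14 & x ^+ 2 + 27 * x + 181 = 0 :> R.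
  by apply: (Poly_root_between q23E); lra.
(* [- x12] is no Pareto eigenvalue, but it completes the list of roots. *)
have r12 : {in [:: - x12; x12], forall x, x ^+ 2 - 328 = 0}.
  by move=> x; rewrite !inE => /orP[]/eqP->; rewrite ?sqrrN.
have r13 : {in [:: y13; x13], forall x, x ^+ 2 - 5 * x - 22 = 0}.
  by move=> x; rewrite !inE => /orP[]/eqP->.
have r23 : {in [:: y23; x23], forall x, x ^+ 2 + 27 * x + 181 = 0}.
  by move=> x; rewrite !inE => /orP[]/eqP->.
have r123 : {in [:: x123; y123; z123], forall x, chi x = 0 /\ - (136 / 11) < x < 18}.
  by move=> x; rewrite !inE => /or3P[]/eqP->; split=> //;
    clear - bx123 by123 bz123; lra.
clear rx12 rx13 ry13 rx23 ry23 rx123 ry123 rz123.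
(* Listed in increasing order, so that distinctness follows from sortedness; [Js] gives the supports
   in the same order. *)
pose L := [:: y23; x23; x123; y123; y13; x13; z123; 16; x12].
pose Js : seq {set 'I_3} := [:: [set 1; 2%:R]; [set 1; 2%:R]; [set: 'I_3]; [set: 'I_3];
  [set 0; 2%:R]; [set 0; 2%:R]; [set: 'I_3]; [set 0]; [set 0; 1]]%SET.
(* Outside [L] the index runs off the end of [Js] and the default is returned; [support_count] looks
   only at the spectrum. *)
pose tau l := nth [set: 'I_3]%SET Js (index l L).
have mem_Js : map mem_ord3 Js =
    [:: [:: false; true; true]; [:: false; true; true]; [:: true; true; true];
        [:: true; true; true]; [:: true; false; true]; [:: true; false; true];
        [:: true; true; true]; [:: true; false; false]; [:: true; true; false]].
  by rewrite /mem_ord3 /= !inE.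
have [uL u12 u13 u23 u123] : [/\ uniq L, uniq [:: - x12; x12], uniq [:: y13; x13],
    uniq [:: y23; x23] & uniq [:: x123; y123; z123]].
  rewrite /L; clear - bx12 bx13 by13 bx23 by23 bx123 by123 bz123.
  by split; apply: lt_sorted_uniq; rewrite /= ?andbT; repeat (apply/andP; split); lra.
have tauE i : (i < 9)%N -> tau (nth 0 L i) = nth [set: 'I_3]%SET Js i.
  by move=> i9; rewrite /tau index_uniq.
have Lreg l : l \in L ->
    is_support (tau l) /\ regularly_produced (A153 R) (tau l) l.
  move=> lL; have l9 : (index l L < 9)%N by rewrite index_mem.
  split.
    have : tau l \in Js by exact: mem_nth.
    rewrite /is_support -(mem_map mem_ord3_inj) mem_Js; apply: contraTneq => ->.
    by rewrite /mem_ord3 !inE.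
  rewrite -(nth_index 0 lL); move: (index l L) l9 => i i9; rewrite (tauE _ i9).
  move: i i9; do 9?[case=> [_|]] => //=.
  - apply: (regularly_produced_A153_23 u23) => //; first by rewrite !inE eqxx.
    by clear - by23; lra.
  - apply: (regularly_produced_A153_23 u23) => //; first by rewrite !inE eqxx orbT.
    by clear - bx23; lra.
  - by apply: (regularly_produced_A153_123 u123) => //; rewrite !inE eqxx.
  - by apply: (regularly_produced_A153_123 u123) => //; rewrite !inE eqxx orbT.
  - apply: (regularly_produced_A153_13 u13) => //; first by rewrite !inE eqxx.
    by clear - by13; lra.
  - apply: (regularly_produced_A153_13 u13) => //; first by rewrite !inE eqxx orbT.
    by clear - bx13; lra.
  - by apply: (regularly_produced_A153_123 u123) => //; rewrite !inE eqxx !orbT.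
  - exact: regularly_produced_A153_1.
  - apply: (regularly_produced_A153_12 u12) => //; first by rewrite !inE eqxx orbT.
    by clear - bx12; lra.
have Lpareto l : pareto_eigenvalue (A153 R) l <-> l \in L.
  split=> [|/Lreg[J0 [_ [u lu _]]]]; last exact: producing_vector_pareto J0 lu.
  move=> /pareto_A153_equation[->|[[l0]|||]]; first by rewrite !inE eqxx !orbT.
  - move=> /(monic_roots (c := [:: _; _]) q12E u12 erefl r12).
    rewrite !inE => /orP[]/eqP lE; last by rewrite lE eqxx !orbT.
    (* The remaining root [- x12] contradicts 0 < l. *)
    by move: l0; rewrite lE; clear - bx12; lra.
  - move=> /(monic_roots (c := [:: _; _]) q13E u13 erefl r13).
    by rewrite !inE => /orP[]/eqP->; rewrite eqxx ?orbT.
  - move=> /(monic_roots (c := [:: _; _]) q23E u23 erefl r23).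
    by rewrite !inE => /orP[]/eqP->; rewrite eqxx ?orbT.
  - move=> /(monic_roots (c := [:: _; _; _]) chiE u123 erefl (fun x xs => (r123 x xs).1)).
    by rewrite !inE => /or3P[]/eqP->; rewrite eqxx ?orbT.
split.
  (* All of [L] is regular, so the regular spectrum is the whole spectrum. *)
  apply: card_eq_seq uL _ => l; split=> [[/Lpareto//]|lL].
  by split; [exact/Lpareto|exists (tau l); have [] := Lreg l lL].
exists tau; split.
  by move=> l /Lpareto/Lreg[J0 [_ [u lu _]]]; split => //; exists u.
(* Hence m_J is the number of occurrences of J in [Js]. *)
have mtau : map tau L = Js.
  apply: (@eq_from_nth _ [set: 'I_3]%SET) => // i; rewrite size_map => i9.
  by rewrite (nth_map 0)// tauE.
have cnt J : support_count (A153 R) tau J (count_mem (mem_ord3 J) (map mem_ord3 Js)).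
  rewrite count_map (eq_count (a2 := pred1 J)); last first.
    by move=> K /=; rewrite (inj_eq mem_ord3_inj).
  rewrite -mtau count_map -size_filter; apply: card_eq_seq; first exact: filter_uniq.
  move=> l; rewrite mem_filter /=; split=> [[/Lpareto-> ->]|/andP[/eqP <- /Lpareto]].
    by rewrite eqxx.
  by split.
rewrite mem_Js in cnt.
by split; [split|split; [split|]]; match goal with |- support_count _ _ ?J _ =>
  have := cnt J; rewrite /mem_ord3 !inE end.
Qed.
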